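(* For all integers $m\ge 2$ and all $n\in\mathbb{N}$, we have $g_m(n)\le 2n$ if and only if $(m,n)\notin\{(2,2),(2,3),(3,4)\}$.
   Context: $\mathbb{N}=\{0,1,2,\dots\}$. For an integer $m\ge 2$, an $m$-product sequence is a finite sequence of integers $a_1\le a_2\le\dots\le a_t$ such that $\prod_{i=1}^t a_i=R^m$ for some $R\in\mathbb{N}$ and no integer appears more than $m-1$ times in the sequence. For $n\in\mathbb{N}$, $g_m(n)$ is the least integer $s$ such that there exists an $m$-product sequence $a_1\le\dots\le a_t$ with $a_1=n$ and $a_t=s$. *)

(* Defs.v *)
From mathcomp Require Import all_boot all_order all_algebra.
From mathcomp Require Import boolp classical_sets.
Set Implicit Arguments.
Unset Strict Implicit.
Unset Printing Implicit Defensive.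
Import Order.TTheory GRing.Theory Num.Theory.
Local Open Scope classical_set_scope.
Local Open Scope ring_scope.

Definition product_sequence (m : nat) (a : seq int) : Prop :=
  [/\ sorted <=%R a,
      exists R : nat, \prod_(x <- a) x = R%:Z ^+ m
    & forall x : int, (count_mem x a <= m.-1)%N].

(* The nonempty sequences starting at n are those of the form n :: a; their
   last term is last n a. *)
Definition last_terms (m n : nat) : set int :=
  [set s | exists a : seq int,
             product_sequence m (n%:Z :: a) /\ last n%:Z a = s].

Definition is_least (A : set int) (s : int) : Prop := A s /\ lbound A s.

(* The default value 0 is never used when m >= 2: see gP. *)
Definition g (m n : nat) : int := xget 0 [set s | is_least (last_terms m n) s].

Lemma last_terms_ge (m n : nat) : lbound (last_terms m n) n%:Z.
Proof.
move=> s [a [[/= sa _ _] <-]].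
have: all (<=%R n%:Z) a by apply: order_path_min sa; exact: le_trans.
by case/lastP: a {sa} => //= a x; rewrite all_rcons last_rcons => /andP[].
Qed.

(* n * (2 ^ m * n) ^ (m - 1) is an m-th power. *)
Lemma last_terms_neq0 (m n : nat) : (2 <= m)%N -> last_terms m n !=set0.
Proof.
case: m => [|[|m]] // _; case: n => [|n].
  exists 0, [::]; split=> //; split=> //; first by exists 0%N; rewrite big_seq1 expr0n.
  by move=> x /=; case: eqP.
set p := (2 ^ m.+2 * n.+1)%N.
have ltnp : (n.+1 < p)%N.
  by rewrite /p ltn_Pmull // (leq_trans _ (ltn_expl m.+2 (ltnSn 1))).
exists (last n.+1%:Z (nseq m.+1 p%:Z)), (nseq m.+1 p%:Z); split=> //; split.
- rewrite /= lez_nat (ltnW ltnp) /=.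
  by elim: (m) => //= k ->; rewrite lexx.
- exists (2 ^ m.+1 * n.+1)%N.
  have pow2 k : (2 ^ k)%N%:Z = 2 ^+ k :> int by rewrite -natz natrX.
  rewrite big_cons big_nseq iter_mulr_1 /p !PoszM !pow2 !exprMn mulrCA -exprS.
  by rewrite -!exprM [in RHS]mulnS exprD.
- move=> x; rewrite [count_mem _ _]/= count_nseq /=.
  case: (eqVneq n.+1%:Z x) => [<-|_]; last by case: (_ == _); rewrite ?mul1n.
  by rewrite eqz_nat (gtn_eqF ltnp).
Qed.

Lemma gP (m n : nat) : (2 <= m)%N -> is_least (last_terms m n) (g m n).
Proof.
move=> m2; rewrite /g; case: xgetP => [s _ //|noleast]; exfalso.
have [s0 s0P] := last_terms_neq0 n m2.
have exk : exists k : nat, `[< last_terms m n k%:Z >].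
  exists `|s0|%N; apply/asboolP; rewrite gez0_abs //.
  by apply: le_trans (last_terms_ge s0P).
case: (ex_minnP exk) => k /asboolP kP kmin.
apply: (noleast k%:Z); split=> // s sP.
have s_ge0 : 0 <= s by apply: le_trans (last_terms_ge sP).
rewrite -(gez0_abs s_ge0) lez_nat; apply: kmin; apply/asboolP.
by rewrite gez0_abs.
Qed.

(* Main.v *)
Require Import Defs.
From mathcomp Require Import all_boot all_order all_algebra.
From mathcomp Require Import zify ring.
Import Order.TTheory GRing.Theory Num.Theory.
Local Open Scope ring_scope.
Set Implicit Arguments.
Unset Strict Implicit.

(** Write a product sequence as a product of powers with exponents below [m].
If [2 * x ^ 2], [y ^ 2] and [x * y] are distinct and lie strictly between [n]
and [2 * n], then
[n * (2 * n) ^ (m - 1) * (2 * x ^ 2) * y ^ 2 * (x * y) ^ (m - 2)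
= (2 * n * x * y) ^ m]
shows [g m n <= 2 * n]. For [n > 64] one takes [x] maximal with [x ^ 2 < n] and
[y = x + 3]; the remaining [n] are settled by a finite search and a few explicit
products. In the exceptional cases, the valuations at 2 and 3 of a product of
integers in [[n, 2 * n]], using [n] and each integer fewer than [m] times, cannot
both be divisible by [m]. *)

(** * Upper bounds for [g] from unordered lists of powers *)

Lemma g_leP (m n k : nat) : (2 <= m)%N ->
  g m n <= k%:Z <-> exists2 s, last_terms m n s & s <= k%:Z.
Proof.
move=> m2; have [gs gmin] := gP n m2.
by split=> [le|[s /gmin]]; [exists (g m n) | exact: le_trans].
Qed.

Lemma prodz_nat (s : seq nat) :
  \prod_(x <- [seq x%:Z | x <- s]) x = (\prod_(x <- s) x)%N%:Z.
Proof. by elim: s => [|x s IHs]; rewrite ?big_nil //= !big_cons IHs PoszM. Qed.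

Lemma expz_nat (a k : nat) : (a ^ k)%N%:Z = a%:Z ^+ k.
Proof. by rewrite -!natz natrX. Qed.

(** Products and multiplicities survive sorting, so a witness may be listed in any order. *)
Lemma g_le_seq (m n k R : nat) (s : seq nat) : (2 <= m)%N ->
  n \in s -> all (fun x => n <= x <= k)%N s ->
  (forall x, count_mem x s <= m.-1)%N -> (\prod_(x <- s) x = R ^ m)%N ->
  g m n <= k%:Z.
Proof.
move=> m2 ns /allP sb cs pR; apply/g_leP=> //.
have := sort_sorted leq_total s; have := perm_sort leq s.
case: (sort leq s) => [|a t] /permPl st; first by rewrite -(perm_mem st) in ns.
move=> so.
have an : a = n.
  apply/eqP; rewrite eqn_leq; apply/andP; split.
    move: ns; rewrite -(perm_mem st) inE => /predU1P[-> //|nt].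
    by have /allP := order_path_min leq_trans so; apply.
  by have /sb/andP[] : a \in s by rewrite -(perm_mem st) mem_head.
subst a; exists (last n t)%:Z; last first.
  have /sb/andP[_] : last n t \in s by rewrite -(perm_mem st) mem_last.
  by rewrite lez_nat.
exists [seq x%:Z | x <- t]; split; last by rewrite last_map.
rewrite -[_ :: _]/[seq x%:Z | x <- n :: t]; split.
- by rewrite sorted_map; apply: sub_sorted so => x y /=; rewrite lez_nat.
- by exists R; rewrite prodz_nat (perm_big _ st) pR expz_nat.
- case=> x; rewrite count_map.
    rewrite (eq_count (a2 := pred1 x)) => [|y /=]; last by rewrite eqz_nat.
    by rewrite (seq.permP st).
  by rewrite (eq_count (a2 := pred0)) ?count_pred0.
Qed.

Definition expand (c : seq (nat * nat)) : seq nat :=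
  flatten [seq nseq p.2 p.1 | p <- c].

Lemma mem_expand (c : seq (nat * nat)) (x : nat) :
  x \in expand c = has (fun p => (p.1 == x) && (0 < p.2)%N) c.
Proof.
by elim: c => //= p c IHc; rewrite mem_cat mem_nseq IHc andbC [x == _]eq_sym.
Qed.

Lemma count_expand (c : seq (nat * nat)) (k x : nat) :
  uniq (unzip1 c) -> all (fun p => p.2 <= k)%N c ->
  (count_mem x (expand c) <= k)%N.
Proof.
elim: c => //= p c IHc /andP[pc uc] /andP[pk ck].
rewrite count_cat count_nseq /=; have [px|_] := eqVneq; last exact: IHc.
rewrite mul1n (count_memPn _) ?addn0 //; apply: contra pc.
rewrite mem_expand => /hasP[q qc /andP[/eqP qx _]].
by apply/mapP; exists q; rewrite // qx.
Qed.

Lemma prod_expand (c : seq (nat * nat)) :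
  (\prod_(x <- expand c) x = \prod_(p <- c) p.1 ^ p.2)%N.
Proof.
elim: c => [|p c IHc]; first by rewrite !big_nil.
by rewrite /= big_cat big_cons IHc big_nseq iter_muln_1.
Qed.

(** Only the exponent of [n] has to be positive: one list can then serve a whole range of [m], even
    where an exponent such as [m - 2] vanishes. *)
Lemma g_le_powers (m n k R : nat) (c : seq (nat * nat)) : (2 <= m)%N ->
  has (fun p => (p.1 == n) && (0 < p.2)%N) c -> uniq (unzip1 c) ->
  all (fun x => n <= x <= k)%N (unzip1 c) -> all (fun p => p.2 <= m.-1)%N c ->
  (\prod_(p <- c) p.1 ^ p.2 = R ^ m)%N -> g m n <= k%:Z.
Proof.
move=> m2 nc uc /allP cb cm cR; apply: (@g_le_seq m n k R (expand c)) => //.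
- by rewrite mem_expand.
- apply/allP => x; rewrite mem_expand => /hasP[p pc /andP[/eqP<- _]].
  by apply: cb; apply: map_f.
- by move=> x; apply: count_expand.
- by rewrite prod_expand.
Qed.

(** * Explicit products with all factors at most [2 * n] *)

Definition square_pair (n x y : nat) : bool :=
  let c := [:: n; 2 * n; 2 * x ^ 2; y ^ 2; x * y]%N in
  uniq c && all (fun z => n <= z <= 2 * n)%N c.

Lemma g_le_square_pair (m n x y : nat) : (2 <= m)%N ->
  square_pair n x y -> g m n <= (2 * n)%N%:Z.
Proof.
case: m => [|[|m]] // m2 /andP[uc bc].
apply: (@g_le_powers _ _ _ (2 * n * x * y)
  [:: (n, 1); (2 * n, m.+1); (2 * x ^ 2, 1); (y ^ 2, 1); (x * y, m)]%N) => //.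
- by rewrite /= eqxx.
- by rewrite /= leqnn leqnSn.
- by rewrite !big_cons big_nil /= !expnS !expnMn !expn0; ring.
Qed.

Lemma sqrt_lt_exists (n : nat) : (0 < n)%N ->
  exists x, (x * x < n <= x.+1 * x.+1)%N.
Proof.
elim: n => // -[|n] IHn _; first by exists 0%N.
have [//|x /andP[x1 x2]] := IHn.
have [le|gt] := leqP n.+2 (x.+1 * x.+1); first by exists x; rewrite le; lia.
by exists x.+1; nia.
Qed.

Lemma square_pair_large (n : nat) : (64 < n)%N -> exists x y, square_pair n x y.
Proof.
move=> n64; have [|x /andP[x1 x2]] := @sqrt_lt_exists n; first by lia.
(* The bound 64 comes from [(x + 3) ^ 2 < 2 * n]: as [n >= x ^ 2 + 1], it suffices that
   [(x - 7) * (x + 1) > 0]. *)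
have x8 : (8 <= x)%N by nia.
exists x, (x + 3)%N; rewrite /square_pair /= !inE !negb_or !andbT -!mulnn.
by repeat (apply/andP; split); nia.
Qed.

(** From 5 to 64 this omits only 6, 7, 8, 9, 12, 15, 16 and 24, which get products of their own. *)
Definition square_pair_range : seq nat :=
  [:: 5; 10; 11; 13; 14] ++ iota 17 7 ++ iota 25 40.

Lemma square_pair_small (n : nat) : n \in square_pair_range ->
  exists x y, square_pair n x y.
Proof.
(* For [k <= 64], both [2 * x ^ 2] and [y ^ 2] are at most 128, so searching up to 12 is enough. *)
pose found k := has (fun x => has (square_pair k x) (iota 1 12)) (iota 1 12).
have fall : all found square_pair_range by vm_compute.
by move=> /(allP fall)/hasP[x _ /hasP[y _ xy]]; exists x, y.
Qed.

(** Here [n * z * (x * y) ^ (m - 1) = (x * y) ^ m]. *)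
Lemma g_le_equal_products (m n x y z : nat) : (2 <= m)%N -> (n * z = x * y)%N ->
  uniq [:: n; z; x; y] -> all (fun t => n <= t <= 2 * n)%N [:: n; z; x; y] ->
  g m n <= (2 * n)%N%:Z.
Proof.
case: m => [|m] // m2 nz uc bc.
apply: (@g_le_powers _ _ _ (x * y)
  [:: (n, 1); (z, 1); (x, m); (y, m)]%N) => //.
- by rewrite /= eqxx.
- by rewrite /= leqnn !andbT !andbb.
- by rewrite !big_cons big_nil /= !expn1 muln1 mulnA nz -expnMn -expnS.
Qed.

Lemma g_le_double_ge5 (m n : nat) : (2 <= m)%N -> (5 <= n)%N ->
  g m n <= (2 * n)%N%:Z.
Proof.
move=> m2 n5; have [n64|n64] := leqP n 64; last first.
  by have [x [y]] := square_pair_large n64; apply: g_le_square_pair.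
have [|nP] := boolP (n \in square_pair_range).
  by move=> /square_pair_small[x [y]]; apply: g_le_square_pair.
have: (n \in [:: 6; 7; 8; 9; 12; 15; 16; 24])%N.
  by move: nP; rewrite /square_pair_range !mem_cat !mem_iota !inE; lia.
case: m m2 => [|[|m]] // m2.
rewrite !inE => /or4P[|||/or4P[|||/orP[]]]; do ?[by move=> /orP[]] => /eqP->.
(* The power sought is now the [m.+2]-th. The cases 7 and 9 rest on [14 * 8 * 9 = 7 * 12 ^ 2] and
   [9 * 16 = 12 ^ 2], the others on equal products such as [6 * 12 = 8 * 9]. *)
- exact: (@g_le_equal_products _ 6 8 9 12).
- apply: (@g_le_powers _ 7 14 (7 * 12)
    [:: (7, m.+1); (14, 1); (8, 1); (9, 1); (12, m)]%N) => //.
    by rewrite /= leqnn leqnSn.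
  by rewrite !big_cons big_nil /= expnMn !expnS !expn0; ring.
- exact: (@g_le_equal_products _ 8 10 12 15).
- apply: (@g_le_powers _ 9 18 12 [:: (9, 1); (16, 1); (12, m)]%N) => //.
    by rewrite /= leqnSn.
  by rewrite !big_cons big_nil /= !expnS !expn0; ring.
- exact: (@g_le_equal_products _ 12 14 18 21).
- exact: (@g_le_equal_products _ 15 18 20 24).
- exact: (@g_le_equal_products _ 16 18 24 27).
- exact: (@g_le_equal_products _ 24 26 36 39).
Qed.

(** For [m >= 3], [2 ^ 2 * 4 ^ (m - 1) = 4 ^ m] and [3 ^ (m - 2) * 6 ^ 2 * 4 ^ (m - 1) = 12 ^ m];
    for [m >= 4], [4 ^ (m - 3) * 8 ^ 2 = 4 ^ m]. In the remaining cases [n] alone is an [m]-th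
    power. *)
Lemma g_le_double_lt5 (m n : nat) : (2 <= m)%N -> (n < 5)%N ->
  (m, n) \notin [:: (2, 2); (2, 3); (3, 4)]%N -> g m n <= (2 * n)%N%:Z.
Proof.
case: m => [|[|m]] // m2.
case: n => [|[|[|[|[|]]]]] // _ mn.
- by apply: (@g_le_powers _ 0 0 0 [:: (0, 1)]%N) => //; rewrite big_seq1 /= exp0n.
- by apply: (@g_le_powers _ 1 2 1 [:: (1, 1)]%N) => //; rewrite big_seq1 /= !exp1n.
- case: m m2 mn => // m _ _.
  apply: (@g_le_powers _ 2 4 4 [:: (2, 2); (4, m.+2)]%N) => //.
    by rewrite /= leqnn.
  by rewrite !big_cons big_nil /= !expnS !expn0; ring.
- case: m m2 mn => // m _ _.
  apply: (@g_le_powers _ 3 6 (3 * 4) [:: (3, m.+1); (6, 2); (4, m.+2)]%N) => //.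
    by rewrite /= leqnn leqnSn.
  by rewrite !big_cons big_nil /= expnMn !expnS !expn0; ring.
- case: m m2 mn => [|[|m]] // _ _.
    by apply: (@g_le_powers _ 4 8 2 [:: (4, 1)]%N); rewrite // big_seq1.
  apply: (@g_le_powers _ 4 8 4 [:: (4, m.+1); (8, 2)]%N) => //.
    by rewrite /= (leq_trans (leqnSn _)).
  by rewrite !big_cons big_nil /= !expnS !expn0; ring.
Qed.

(** * Valuations as an obstruction *)

Lemma sum_count_mem (s r : seq nat) (f : nat -> nat) :
  uniq r -> {subset s <= r} ->
  (\sum_(x <- s) f x = \sum_(x <- r) f x * count_mem x s)%N.
Proof.
move=> ur; elim: s => [|y s IHs] sr.
  by rewrite big_nil big1 // => x _; rewrite muln0.
rewrite big_cons IHs => [|x xs]; last by apply: sr; rewrite inE xs orbT.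
under [in RHS]eq_bigr => x _ do rewrite /= mulnDr.
rewrite big_split /=; congr (_ + _)%N.
rewrite (bigD1_seq y) ?sr ?mem_head //= eqxx muln1 big1 ?addn0 // => x xy.
by rewrite eq_sym (negPf xy) muln0.
Qed.

Lemma logn_prod_seq (p : nat) (s : seq nat) : all (leq 1) s ->
  logn p (\prod_(x <- s) x)%N = (\sum_(x <- s) logn p x)%N.
Proof.
elim: s => [|x s IHs] /=; first by rewrite !big_nil logn1.
move=> /andP[x0 s0]; rewrite !big_cons lognM ?IHs //.
by rewrite big_seq prodn_cond_gt0 // => y /(allP s0).
Qed.

Lemma path_le_last (x y : int) (a : seq int) :
  path <=%R x a -> y \in x :: a -> y <= last x a.
Proof.
elim: a x y => [|z a IHa] x y /=; first by rewrite inE => _ /eqP->.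
move=> /andP[xz pa]; rewrite inE => /predU1P[->|ya]; last exact: IHa.
by apply: (le_trans xz); apply: IHa; rewrite ?mem_head.
Qed.

(** Take for [e] the multiplicities in a product sequence ending at or below [k]; each sum is then
    the valuation at [p] of an [m]-th power. *)
Lemma g_le_valuation (m n k : nat) : (2 <= m)%N -> (0 < n)%N -> (n <= k)%N ->
  g m n <= k%:Z ->
  exists e : nat -> nat, [/\ (0 < e n)%N, forall x, (e x <= m.-1)%N &
    forall p, (m %| \sum_(x <- iota n (k.+1 - n)) logn p x * e x)%N].
Proof.
move=> m2 n0 nk /(@g_leP _ _ _ m2)[_ [a [[sa [R aR] ca] <-]] le].
have ab : forall x : int, x \in n%:Z :: a -> n%:Z <= x <= k%:Z.
  move=> x xa; apply/andP; split.
    move: xa; rewrite inE => /predU1P[-> //|xa].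
    by have /allP := order_path_min le_trans sa; apply.
  exact: le_trans (path_le_last sa xa) le.
pose s := [seq `|x|%N | x <- n%:Z :: a].
have as_ : n%:Z :: a = [seq x%:Z | x <- s].
  rewrite /s -map_comp -[LHS]map_id; apply/eq_in_map => x /ab/andP[xn _] /=.
  by rewrite gez0_abs // (le_trans _ xn).
have sb x : x \in s -> (n <= x <= k)%N.
  move=> xs; rewrite -!lez_nat; apply: ab.
  by rewrite as_ mem_map // => ? ? [].
have sR : (\prod_(x <- s) x = R ^ m)%N.
  by apply/eqP; rewrite -eqz_nat -prodz_nat -as_ aR expz_nat.
exists (fun x => count_mem x s); split.
- by rewrite -has_count has_pred1 mem_head.
- move=> x; apply: leq_trans (ca x%:Z); rewrite as_ [leqRHS]count_map.
  by apply/eq_leq/eq_count => y /=; rewrite eqz_nat.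
- move=> p; rewrite -sum_count_mem ?iota_uniq //; last first.
    by move=> x /sb; rewrite mem_iota; lia.
  rewrite -logn_prod_seq ?sR ?lognX ?dvdn_mulr //.
  by apply/allP => x /sb; lia.
Qed.

Unset Implicit Arguments.
Set Strict Implicit.

Theorem theorem4p10 (m n : nat) (hm : (2 <= m)%N) :
  g m n <= (2 * n)%N%:Z <->
  (m, n) \notin [:: (2, 2); (2, 3); (3, 4)]%N.
Proof.
have logn2 :
    ((logn 2 2 = 1%N) * (logn 2 3 = 0%N) * (logn 2 4 = 2%N) * (logn 2 5 = 0%N)
     * (logn 2 6 = 1%N) * (logn 2 7 = 0%N) * (logn 2 8 = 3%N))%type by [].
have logn3 :
    ((logn 3 3 = 1%N) * (logn 3 4 = 0%N) * (logn 3 5 = 0%N) * (logn 3 6 = 1%N)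
     * (logn 3 7 = 0%N) * (logn 3 8 = 0%N))%type by [].
split; last first.
  have [n5|n5] := leqP 5 n; last exact: g_le_double_lt5.
  by move=> _; apply: g_le_double_ge5.
move=> le; rewrite !inE !xpair_eqE.
apply/negP => /or3P[] /andP[/eqP mE /eqP nE]; subst m n.
- have [e [e1 eb ed]] := @g_le_valuation 2 2 4 hm isT isT le.
  (* The bounds force [e 2 = 1], which makes the valuation [e 2 + 2 * e 4] odd. *)
  have := ed 2%N; rewrite !big_cons big_nil !logn2.
  have := eb 2%N; lia.
- have [e [e1 eb ed]] := @g_le_valuation 2 3 6 hm isT isT le.
  (* Since [e 3 = 1], evenness of [e 3 + e 6] gives [e 6 = 1], and then [2 * e 4 + e 6] is odd. *)
  have := ed 3%N; have := ed 2%N; rewrite !big_cons !big_nil !logn2 !logn3.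
  have := eb 3%N; have := eb 6%N; lia.
- have [e [e1 eb ed]] := @g_le_valuation 3 4 8 hm isT isT le.
  (* At 3 the valuation is [e 6 <= 2], so [e 6 = 0]; at 2, divisibility of [2 * e 4 + 3 * e 8] by 3
     then contradicts [0 < e 4 <= 2]. *)
  have := ed 3%N; have := ed 2%N; rewrite !big_cons !big_nil !logn2 !logn3.
  have := eb 4%N; have := eb 6%N; lia.
Qed.
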